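(* Let $m\geq 2$ and let $|\cdot|$ be any expanding norm on $\mathbb{R}^m$. Let $\underline{e}_i=(0,\ldots,0,1,0,\ldots,0)$, $1\leq i\leq m$, be the canonical base vectors and let $\chi:=\min_{1\leq i\leq m}|\underline{e}_i|>0$. Then $[0,\chi]\subseteq\mathbb{D}_m^{|\cdot|}$, where $\mathbb{D}_m^{|\cdot|}$ is the Dirichlet spectrum with respect to $|\cdot|$.
   Context: A norm $|\cdot|$ on $\mathbb{R}^m$ is called expanding if $|\underline{x}|\geq|\pi_j(\underline{x})|$ for all $\underline{x}\in\mathbb{R}^m$ and $1\leq j\leq m$, where $\pi_j$ is the orthogonal projection to the $j$-th coordinate axis, $\pi_j(\underline{x})=x_j\underline{e}_j$. For $x\in\mathbb{R}$ let $\Vert x\Vert$ be the distance of $x$ to the nearest integer. For $\underline{\xi}=(\xi_1,\ldots,\xi_m)\in\mathbb{R}^m$, the Dirichlet constant with respect to $|\cdot|$ is $$\Theta^{|\cdot|}(\underline{\xi})=\limsup_{Q\to\infty}\,Q^{1/m}\min_{1\leq q\leq Q}\Big|\sum_{i=1}^m\Vert q\xi_i\Vert\,\underline{e}_i\Big|,$$ where $q$ ranges over positive integers up to $Q$, and $\mathbb{D}_m^{|\cdot|}=\{\Theta^{|\cdot|}(\underline{\xi}):\underline{\xi}\in\mathbb{R}^m\}$. *)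

(* Defs.v *)
From HB Require Import structures.
From mathcomp Require Import all_boot all_order all_algebra.
From mathcomp Require Import all_classical all_reals all_analysis.

Set Implicit Arguments.
Unset Strict Implicit.
Unset Printing Implicit Defensive.

Import Order.TTheory GRing.Theory Num.Theory.
Import numFieldNormedType.Exports.

Local Open Scope classical_set_scope.
Local Open Scope ring_scope.

(* Norms on R^m are plain functions on row vectors: the canonical norm of
   'rV[R]_m in the library is the sup norm, whereas the norm varies here. *)
Record is_norm (R : realType) (m : nat) (N : 'rV[R]_m -> R) : Prop := IsNorm {
  is_norm_eq0 : forall x, N x = 0 -> x = 0;
  is_normZ : forall (a : R) x, N (a *: x) = `|a| * N x;
  is_normD : forall x y, N (x + y) <= N x + N y
}.

Definition base_vec (R : realType) (m : nat) (i : 'I_m) : 'rV[R]_m :=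
  delta_mx 0 i.

Definition axis_proj (R : realType) (m : nat) (j : 'I_m) (x : 'rV[R]_m) :
    'rV[R]_m :=
  x 0 j *: base_vec R j.

Definition expanding (R : realType) (m : nat) (N : 'rV[R]_m -> R) : Prop :=
  forall (x : 'rV[R]_m) (j : 'I_m), N (axis_proj j x) <= N x.

Definition dist_int (R : realType) (x : R) : R :=
  inf [set `|x - n%:~R| | n in [set: int]].

Definition approx_vec (R : realType) (m : nat) (xi : 'rV[R]_m) (q : nat) :
    'rV[R]_m :=
  \sum_(i < m) dist_int (q%:R * xi 0 i) *: base_vec R i.

(* Q is real; for Q >= 1 the set is finite and nonempty, so its infimum is a
   minimum.  The values for Q < 1 do not affect the limit superior below. *)
Definition min_approx (R : realType) (m : nat) (N : 'rV[R]_m -> R)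
    (xi : 'rV[R]_m) (Q : R) : R :=
  inf [set N (approx_vec xi q) | q in [set q : nat | (0 < q)%N /\ q%:R <= Q]].

(* The limit superior is taken in the extended reals, so that no boundedness
   is presupposed. *)
Definition dirichlet_constant (R : realType) (m : nat) (N : 'rV[R]_m -> R)
    (xi : 'rV[R]_m) : \bar R :=
  limf_esup (fun Q : R => (Q `^ (m%:R^-1) * min_approx N xi Q)%:E)
    (pinfty_nbhs R).

Definition dirichlet_spectrum (R : realType) (m : nat) (N : 'rV[R]_m -> R) :
    set (\bar R) :=
  range (dirichlet_constant N).

(* The range is finite, and nonempty as soon as 0 < m: the infimum is then a
   minimum. *)
Definition chi (R : realType) (m : nat) (N : 'rV[R]_m -> R) : R :=
  inf (range (fun i : 'I_m => N (base_vec R i))).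

(* Main.v *)
Require Import Defs.
From HB Require Import structures.
From mathcomp Require Import all_boot all_order all_algebra.
From mathcomp Require Import all_classical all_reals all_analysis.
From mathcomp Require Import perm ring lra.

Set Implicit Arguments.
Unset Strict Implicit.
Unset Printing Implicit Defensive.

Import Order.TTheory GRing.Theory Num.Theory.
Import numFieldNormedType.Exports.

Local Open Scope classical_set_scope.
Local Open Scope ring_scope.

(** Write m = n + 1 and let e_{i0} be a base vector of least norm, so that
    chi = |e_{i0}|; let c = l * chi be the target, 0 <= l <= 1.  The vector xi
    is built from lacunary sums of unit fractions that converge in stages.

    At the start of stage k the partial sums of all coordinates have the common
    denominator D = level k.  The stage picks base b = D^2 s and gap L = D^2 K
    with s <= K, and adds 1/b, 1/b^2, ..., 1/b^n to the coordinates other than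
    i0, one power to each, and 1/(b^n L) to coordinate i0.  The next common
    denominator is D' = b^n L, and the next base is so much larger than D' that
    for q <= D' the rest of the sums displaces q xi by a negligible amount,
    tail k.

    Approximations: q = D is good enough for Q < b, then q = b for Q < b^n, in
    both cases with Q^(1/m) |q xi| at most of order s^(-1/m)
    (dirichlet_fun_small).  For b^n <= Q < D', take q = b^n: the only sizeable
    coordinate of its approximation vector is coordinate i0, equal to 1/L, and
    so the vector has norm about chi / L (dirichlet_fun_large).

    No q < D' does better (dist_xi_ge): if b^n divides q, the numerator that q
    leaves in coordinate i0 is a nonzero class modulo L; otherwise there is a
    j < n such that b^j but not b^(j+1) divides q, and then the coordinate that
    received 1/b^(j+1) is at distance at least 1/b >= 1/L from the integers.
    This is where b is a multiple of D^2: it makes the numerator of that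
    coordinate coprime to b (partial_num).  Since the norm is expanding, one
    coordinate at distance d from the integers forces norm at least
    d |e_i| >= d chi.

    Hence the function Q^(1/m) min |q xi| peaks just before D', at about
    chi * peak k, where peak k = D'^(1/m) / L and (peak k)^m = (s/K)^n.  It
    remains to choose s and K with s -> oo and s/K -> t, where t^n = l^m. *)

(** * Distance to the integers, norms, and the limit superior *)

(** Used to find the stage that contains a given Q, and the largest power of
    the base that divides a given q. *)
Lemma exists_switch (P : pred nat) (n : nat) :
  P 0%N -> ~~ P n -> exists j, [/\ (j < n)%N, P j & ~~ P j.+1].
Proof.
elim: n => [->//|n IHn] P0 nPn.
have [Pn|nPn'] := boolP (P n); first by exists n.
have [j [jn Pj nPj]] := IHn P0 nPn'.
by exists j; split=> //; exact: ltnW.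
Qed.

Section DistInt.
Variable R : realType.
Implicit Types (x v : R).

Lemma dist_int_le x (n : int) : dist_int x <= `|x - n%:~R|.
Proof.
apply: ge_inf; last by exists n.
by exists 0 => _ [k _ <-]; exact: normr_ge0.
Qed.

Lemma dist_int_ge x v : (forall n : int, v <= `|x - n%:~R|) -> v <= dist_int x.
Proof.
move=> h; apply: lb_le_inf; first by exists `|x - 0%:~R|, 0.
by move=> _ [k _ <-]; exact: h.
Qed.

Lemma dist_int_ge0 x : 0 <= dist_int x.
Proof. by apply: dist_int_ge => n; exact: normr_ge0. Qed.

Lemma dist_frac_ge (a b : nat) (n : int) : (0 < b)%N -> ~~ (b %| a)%N ->
  b%:R^-1 <= `|a%:R / b%:R - n%:~R :> R|.
Proof.
move=> b0 ba.
have bR : 0 < b%:R :> R by rewrite ltr0n.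
have -> : a%:R / b%:R - n%:~R = (a%:Z - n * b%:Z)%:~R / b%:R :> R.
  by rewrite rmorphB rmorphM /= mulrBl mulfK ?gt_eqF.
rewrite normrM (gtr0_norm (_ : 0 < b%:R^-1)) ?invr_gt0//.
rewrite ler_pMl ?invr_gt0// -intr_norm ler1z.
rewrite -gtz0_ge1 normr_gt0 subr_eq0; apply: contra ba => /eqP ba.
suff : (b%:Z %| a%:Z)%Z by [].
by apply/dvdzP; exists n.
Qed.

End DistInt.

Section Norms.
Variables (R : realType) (m : nat) (N : 'rV[R]_m -> R).
Hypothesis hN : is_norm N.

Lemma norm_ge0 x : 0 <= N x.
Proof.
have N0 : N 0 = 0 by rewrite -(scale0r 0) (is_normZ hN) normr0 mul0r.
have : N (x + -1 *: x) <= N x + N (-1 *: x) := is_normD hN _ _.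
by rewrite (is_normZ hN) normrN1 mul1r scaleN1r subrr N0; lra.
Qed.

Lemma norm_sum_le (I : Type) (r : seq I) (F : I -> 'rV[R]_m) :
  N (\sum_(i <- r) F i) <= \sum_(i <- r) N (F i).
Proof.
elim: r => [|i r IHr].
  by rewrite !big_nil -(scale0r 0) (is_normZ hN) normr0 mul0r.
rewrite !big_cons; apply: le_trans (is_normD hN _ _) _.
by rewrite lerD2l.
Qed.

Lemma norm_base_vec_gt0 i : 0 < N (base_vec R i).
Proof.
rewrite lt_neqAle norm_ge0 andbT eq_sym; apply/eqP => /(is_norm_eq0 hN).
by move/matrixP/(_ 0 i); rewrite !mxE !eqxx => /eqP; rewrite oner_eq0.
Qed.

Lemma norm_approx_vec_le (xi : 'rV[R]_m) q :
  N (approx_vec xi q) <=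
  \sum_(i < m) dist_int (q%:R * xi 0 i) * N (base_vec R i).
Proof.
apply: le_trans (norm_sum_le _ _) _; apply: ler_sum => i _.
by rewrite (is_normZ hN) ger0_norm ?dist_int_ge0.
Qed.

(** The only use of the expanding property. *)
Lemma norm_approx_vec_ge (xi : 'rV[R]_m) q j : expanding N ->
  dist_int (q%:R * xi 0 j) * N (base_vec R j) <= N (approx_vec xi q).
Proof.
move=> /(_ (approx_vec xi q) j); rewrite /axis_proj (is_normZ hN).
suff -> : approx_vec xi q 0 j = dist_int (q%:R * xi 0 j).
  by rewrite ger0_norm ?dist_int_ge0.
rewrite summxE (bigD1 j) //= big1 ?addr0 => [|i ij].
  by rewrite !mxE !eqxx mulr1.
by rewrite !mxE eqxx /= eq_sym (negbTE ij) mulr0.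
Qed.

Lemma min_approx_le (xi : 'rV[R]_m) q (Q : R) : (0 < q)%N -> q%:R <= Q ->
  min_approx N xi Q <= N (approx_vec xi q).
Proof.
move=> q0 qQ; apply: ge_inf; last by exists q.
by exists 0 => _ [k _ <-]; exact: norm_ge0.
Qed.

Lemma min_approx_ge (xi : 'rV[R]_m) (Q v : R) : 1 <= Q ->
  (forall q, (0 < q)%N -> q%:R <= Q -> v <= N (approx_vec xi q)) ->
  v <= min_approx N xi Q.
Proof.
move=> Q1 h; apply: lb_le_inf.
  by exists (N (approx_vec xi 1)), 1%N.
by move=> _ [q [q0 qQ] <-]; exact: h.
Qed.

Lemma chi_attained : (0 < m)%N ->
  exists2 i0, chi N = N (base_vec R i0) &
    forall i, N (base_vec R i0) <= N (base_vec R i).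
Proof.
move=> m0; pose M i := N (base_vec R i).
have [i0 _ hi0] := @arg_minP _ _ _ (Ordinal m0) xpredT M isT.
exists i0 => [|i]; last exact: hi0.
apply/le_anti/andP; split.
  apply: ge_inf; last by exists i0.
  by exists 0 => _ [k _ <-]; exact: norm_ge0.
apply: lb_le_inf; first by exists (M i0), i0.
by move=> _ [i _ <-]; exact: hi0.
Qed.

End Norms.

Lemma limf_esup_pinfty_eq (R : realType) (f : R -> R) (c : R) :
  (forall e, 0 < e -> exists M, forall Q, M < Q -> f Q <= c + e) ->
  (forall e M, 0 < e -> exists2 Q, M < Q & c - e <= f Q) ->
  limf_esup (fun Q => (f Q)%:E) (pinfty_nbhs R) = c%:E.
Proof.
move=> hup hlo; apply/le_anti/andP; split.
  apply/lee_addgt0Pr => e e0; have [M hM] := hup _ e0.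
  apply: (@le_trans _ _ (ereal_sup [set (f Q)%:E | Q in [set Q | M < Q]])).
    apply: ereal_inf_lbound; exists [set Q | M < Q] => //.
    by exists M; split=> //; exact: num_real.
  by apply: ge_ereal_sup => _ [Q /= MQ <-]; rewrite -EFinD lee_fin hM.
apply: le_ereal_inf_tmp => _ [V [M [_ hM]] <-].
apply/lee_addgt0Pr => e e0; have [Q MQ hQ] := hlo _ M e0.
rewrite -leeBlDr// -EFinB; apply: (@le_trans _ _ (f Q)%:E).
  by rewrite lee_fin.
by apply: ereal_sup_ubound; exists Q => //; exact: hM.
Qed.

Section Roots.
Variables (R : realType) (n : nat).
Local Notation root x := (x `^ (n.+1%:R^-1)).
Implicit Types (x y : R).

Lemma root_expr x : 0 <= x -> root x ^+ n.+1 = x.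
Proof.
by move=> x0; rewrite -powR_mulrn ?powR_ge0// -powRrM mulVf ?powRr1.
Qed.

(** Lets estimates of x^(1/m) y be checked on m-th powers, where they are
    rational. *)
Lemma mul_root_le x y e : 0 <= x -> 0 <= y -> 0 <= e ->
  x * y ^+ n.+1 <= e ^+ n.+1 -> root x * y <= e.
Proof.
move=> x0 y0 e0 h; rewrite -(@ler_pXn2r _ n.+1) ?nnegrE ?mulr_ge0 ?powR_ge0//.
by rewrite exprMn root_expr.
Qed.

Lemma root_le_id x : 1 <= x -> root x <= x.
Proof. by move=> x1; apply: ler1_powR => //; rewrite invf_le1 ?ler1n. Qed.

Lemma root_mul_id_le x y : 0 <= x -> 0 < y <= 1 -> y * root x <= root (y * x).
Proof.
move=> x0 /andP[y0 y1]; rewrite powRM ?(ltW y0)//.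
apply: ler_wpM2r; first exact: powR_ge0.
by apply: ger1_powR; rewrite ?y0// invf_le1 ?ler1n.
Qed.

End Roots.

(** * Numerators *)

Lemma natr_divn (R : numFieldType) (a d : nat) : (0 < d)%N -> (d %| a)%N ->
  (a %/ d)%:R = a%:R / d%:R :> R.
Proof.
move=> d0 da; rewrite -[in RHS](divnK da) natrM mulfK//.
by rewrite pnatr_eq0 -lt0n.
Qed.

(** x + 1 is coprime to x, hence to its square and to the divisors of that. *)
Lemma coprime_succ_of_dvdn_sqr (b x : nat) :
  (b %| x ^ 2)%N -> coprime b x.+1.
Proof. by move=> /coprime_dvdl; apply; rewrite coprimeXl// coprimenS. Qed.

(** * The vector built from a pair of integer sequences *)

Section Construction.
Variables (R : realType) (n : nat) (i0 : 'I_n.+1) (s K : nat -> nat).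
Hypothesis n0 : (0 < n)%N.
Hypothesis s_gt : forall k, (k < s k)%N.
Hypothesis s_le : forall k, (s k <= K k)%N.

Fixpoint level (k : nat) : nat :=
  if k is j.+1 then ((level j ^ 2 * s j) ^ n * (level j ^ 2 * K j))%N else 1%N.

(** The square is what makes numerators coprime to the base; see
    partial_num. *)
Definition base k : nat := (level k ^ 2 * s k)%N.
Definition gap k : nat := (level k ^ 2 * K k)%N.

(** A numbering of the coordinates in which i0 comes last. *)
Definition rank (i : 'I_n.+1) : 'I_n.+1 := tperm i0 ord_max i.

Definition unit_den (k : nat) (i : 'I_n.+1) : nat :=
  if i == i0 then level k.+1 else (base k ^ (rank i).+1)%N.

Definition partial (k : nat) (i : 'I_n.+1) : R :=
  \sum_(j < k) (unit_den j i)%:R^-1.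

Definition xi : 'rV[R]_n.+1 := \row_i sup (range (fun k => partial k i)).

Lemma levelS k : level k.+1 = (base k ^ n * gap k)%N. Proof. by []. Qed.

Lemma s_gt0 k : (0 < s k)%N. Proof. exact: leq_ltn_trans (s_gt k). Qed.

Lemma K_gt0 k : (0 < K k)%N. Proof. exact: leq_trans (s_gt0 k) (s_le k). Qed.

Lemma level_gt0 k : (0 < level k)%N.
Proof.
by elim: k => // k IHk; rewrite levelS !(muln_gt0, expn_gt0) IHk s_gt0 K_gt0.
Qed.

Lemma base_gt0 k : (0 < base k)%N.
Proof. by rewrite muln_gt0 expn_gt0 level_gt0 s_gt0. Qed.

Lemma gap_gt0 k : (0 < gap k)%N.
Proof. by rewrite muln_gt0 expn_gt0 level_gt0 K_gt0. Qed.

Lemma base_le_gap k : (base k <= gap k)%N.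
Proof. by rewrite leq_mul2l s_le orbT. Qed.

Lemma dvdn_level_base k : (level k %| base k)%N.
Proof. by rewrite /base expnS -mulnA dvdn_mulr. Qed.

Lemma dvdn_base_exp k : (base k %| base k ^ n)%N.
Proof. by rewrite -[X in (X %| _)%N]expn1 dvdn_exp2l. Qed.

Lemma dvdn_base_level k : (base k %| level k.+1)%N.
Proof. exact: dvdn_trans (dvdn_base_exp k) (dvdn_mulr _ _). Qed.

Lemma level_le_base k : (level k <= base k)%N.
Proof. exact: dvdn_leq (base_gt0 k) (dvdn_level_base k). Qed.

Lemma s_le_base k : (s k <= base k)%N.
Proof. by apply: leq_pmull; rewrite expn_gt0 level_gt0. Qed.

Lemma base_le_level k : (base k <= level k.+1)%N.
Proof. exact: dvdn_leq (level_gt0 _) (dvdn_base_level k). Qed.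

Lemma level_mul_s_le_base k : (level k * s k <= base k)%N.
Proof. by rewrite /base expnS expn1 -mulnA leq_pmull ?level_gt0. Qed.

Lemma level_gt k : (k < level k.+1)%N.
Proof.
exact: leq_trans (leq_trans (s_gt k) (s_le_base k)) (base_le_level k).
Qed.

Lemma base_double k : (2 * base k <= base k.+1)%N.
Proof.
rewrite mulnC; apply: leq_trans (level_mul_s_le_base _).
by apply: leq_mul (base_le_level k) (leq_ltn_trans _ (s_gt _)).
Qed.

Lemma rank_i0 : rank i0 = ord_max. Proof. exact: tpermL. Qed.

Lemma rank_lt i : i != i0 -> (rank i < n)%N.
Proof.
move=> ii0; have : rank i != ord_max by rewrite -rank_i0 (inj_eq perm_inj).
by rewrite -val_eqE /= => h; rewrite ltn_neqAle h -ltnS ltn_ord.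
Qed.

Lemma rank_surj j : (j < n)%N -> exists2 i, i != i0 & rank i = j :> nat.
Proof.
move=> jn; exists (tperm i0 ord_max (inord j)).
  rewrite -[X in _ != X](tpermR i0 ord_max) (inj_eq perm_inj).
  by rewrite -(inj_eq val_inj)/= inordK ?ltn_eqF// ltnW.
by rewrite /rank tpermK inordK// ltnW.
Qed.

Lemma dvdn_unit_den_level k i : (unit_den k i %| level k.+1)%N.
Proof.
rewrite /unit_den; case: eqP => // /eqP /rank_lt ri.
by rewrite levelS dvdn_mulr// dvdn_exp2l.
Qed.

Lemma dvdn_base_unit_den k i : (base k %| unit_den k i)%N.
Proof.
rewrite /unit_den; case: eqP => _; first exact: dvdn_base_level.
by rewrite expnS dvdn_mulr.
Qed.

Lemma unit_den_gt0 k i : (0 < unit_den k i)%N.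
Proof. exact: dvdn_gt0 (level_gt0 _) (dvdn_unit_den_level k i). Qed.

Lemma base_le_unit_den k i : (base k <= unit_den k i)%N.
Proof. exact: dvdn_leq (unit_den_gt0 k i) (dvdn_base_unit_den k i). Qed.

Let level_R_gt0 k : 0 < (level k)%:R :> R.
Proof. by rewrite ltr0n level_gt0. Qed.

Let base_R_gt0 k : 0 < (base k)%:R :> R.
Proof. by rewrite ltr0n base_gt0. Qed.

Let gap_R_gt0 k : 0 < (gap k)%:R :> R.
Proof. by rewrite ltr0n gap_gt0. Qed.

Let s_R_gt0 k : 0 < (s k)%:R :> R.
Proof. by rewrite ltr0n s_gt0. Qed.

Let unit_den_R_gt0 k i : 0 < (unit_den k i)%:R :> R.
Proof. by rewrite ltr0n unit_den_gt0. Qed.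

Lemma partialS k i : partial k.+1 i = partial k i + (unit_den k i)%:R^-1.
Proof. by rewrite /partial big_ord_recr. Qed.

Lemma level_mul_partial k i : exists p : nat, (level k)%:R * partial k i = p%:R.
Proof.
elim: k => [|k [p hp]]; first by exists 0%N; rewrite /partial big_ord0 mulr0.
exists (level k.+1 %/ level k * p + level k.+1 %/ unit_den k i)%N.
have DD := dvdn_trans (dvdn_level_base k) (dvdn_base_level k).
rewrite natrD natrM -hp.
rewrite !natr_divn ?level_gt0 ?unit_den_gt0 ?dvdn_unit_den_level//.
by rewrite partialS mulrDr mulrA divfK ?gt_eqF.
Qed.

Lemma partial_frac k i : exists p : nat, partial k i = p%:R / (level k)%:R.
Proof.
have [p hp] := level_mul_partial k i; exists p.
by rewrite -hp mulrC mulKf ?gt_eqF.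
Qed.

(** The upper ends of a nested sequence of intervals around xi: the geometric
    growth of the bases lets 2 / base k absorb all later terms. *)
Lemma partial_upper_anti k i :
  partial k.+1 i + 2 / (base k.+1)%:R <= partial k i + 2 / (base k)%:R.
Proof.
rewrite partialS -addrA lerD2l.
have h1 : (unit_den k i)%:R^-1 <= (base k)%:R^-1 :> R.
  by rewrite lef_pV2 ?posrE// ler_nat base_le_unit_den.
have h2 : 2 / (base k.+1)%:R <= (base k)%:R^-1 :> R.
  by rewrite ler_pdivrMr// mulrC ler_pdivlMr// -natrM ler_nat base_double.
have -> : 2 / (base k)%:R = (base k)%:R^-1 + (base k)%:R^-1 :> R by ring.
exact: lerD.
Qed.

Lemma partial_mono i : {homo partial ^~ i : k l / (k <= l)%N >-> k <= l}.
Proof.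
apply: homo_leq => [x//|y x z|k]; first exact: le_trans.
by rewrite partialS lerDl invr_ge0 ltW.
Qed.

Lemma partial_le_upper k l i : partial l i <= partial k i + 2 / (base k)%:R.
Proof.
have pos j : 0 <= 2 / (base j)%:R :> R by rewrite divr_ge0 ?ltW.
have [lk|kl] := leqP l k.
  by apply: le_trans (partial_mono i lk) _; rewrite lerDl.
apply: (@le_trans _ _ (partial l i + 2 / (base l)%:R)); first by rewrite lerDl.
rewrite -(subnKC (ltnW kl)); elim: (l - k)%N => [|d IHd].
  by rewrite addn0.
by rewrite addnS; exact: le_trans (partial_upper_anti _ _) IHd.
Qed.

Lemma partial_le_xi k i : partial k i <= xi 0 i.
Proof.
rewrite mxE; apply: ub_le_sup; last by exists k.
by exists (partial 0 i + 2 / (base 0)%:R) => _ [l _ <-]; exact: partial_le_upper.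
Qed.

Lemma xi_le_upper k i : xi 0 i <= partial k i + 2 / (base k)%:R.
Proof.
rewrite mxE; apply: ge_sup; first by exists (partial 0 i), 0%N.
by move=> _ [l _ <-]; exact: partial_le_upper.
Qed.

(** This is level k.+1 * (2 / base k.+1), the displacement of q xi by the terms
    after stage k when q <= level k.+1. *)
Definition tail k : R := 2 / ((level k.+1)%:R * (s k.+1)%:R).

Lemma tail_ge0 k : 0 <= tail k.
Proof. by rewrite divr_ge0 ?mulr_ge0 ?ltW. Qed.

Lemma level_mul_tail k : (level k.+1)%:R * tail k = 2 / (s k.+1)%:R.
Proof. by rewrite /tail; field; rewrite !gt_eqF. Qed.

Lemma dist_xi_partial k i q :
  `|q%:R * xi 0 i - q%:R * partial k i| <= q%:R * (2 / (base k)%:R).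
Proof.
rewrite -mulrBr normrM ger0_norm ?ler0n// ler_wpM2l ?ler0n// ger0_norm.
  by rewrite lerBlDl xi_le_upper.
by rewrite subr_ge0 partial_le_xi.
Qed.

Lemma dist_xi_tail k i q : (q <= level k.+1)%N ->
  `|q%:R * xi 0 i - q%:R * partial k.+1 i| <= tail k.
Proof.
move=> qD; apply: le_trans (dist_xi_partial _ _ _) _.
have -> : tail k = (level k.+1)%:R * (2 / (base k.+1)%:R).
  by rewrite /tail /base natrM natrX; field; rewrite !gt_eqF.
by rewrite ler_wpM2r ?ler_nat// divr_ge0 ?ltW.
Qed.

(** With p the numerator over level k before stage k, the new numerator is
    base^(j+1) p / level + 1.  Its first term is a multiple of level * s, and
    (level * s)^2 = base * s. *)
Lemma partial_num k i : i != i0 -> exists2 x : nat,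
  (base k %| x ^ 2)%N &
  partial k.+1 i = x.+1%:R / (base k)%:R ^+ (rank i).+1.
Proof.
move=> ii0; have [p hp] := partial_frac k i; set j := rank i.
exists (base k ^ j * (level k * s k) * p)%N.
  rewrite !expnMn mulnAC; apply: dvdn_mull.
  by rewrite [(s k ^ 2)%N]expnS mulnA dvdn_mulr.
rewrite partialS hp /unit_den (negbTE ii0) -/j -[_.+1%:R]natr1.
rewrite !(natrM, natrX) !exprS expr0.
by field; rewrite !gt_eqF// exprn_gt0 ?mulr_gt0.
Qed.

(** The old fraction has a denominator that divides base^n, so it contributes a
    multiple of the gap to the numerator. *)
Lemma partial_num_i0 k : exists x : nat,
  partial k.+1 i0 = (x * gap k + 1)%:R / ((base k)%:R ^+ n * (gap k)%:R).
Proof.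
have [p hp] := partial_frac k i0; exists (base k ^ n %/ level k * p)%N.
rewrite partialS hp /unit_den eqxx levelS natrD !(natrM _ _ (gap k)) natrM natrX.
rewrite natr_divn ?level_gt0 ?natrX//; last first.
  exact: dvdn_trans (dvdn_level_base k) (dvdn_base_exp k).
by field; rewrite !gt_eqF ?exprn_gt0.
Qed.

(** If base^n divides q, coordinate i0 is far from the integers; otherwise the
    coordinate whose unit fraction is the first power of 1 / base that q fails
    to clear. *)
Lemma dist_partial_ge k q : (0 < q)%N -> (q < level k.+1)%N ->
  exists i, forall z : int,
    (gap k)%:R^-1 <= `|q%:R * partial k.+1 i - z%:~R|.
Proof.
move=> q0 qD; have [/dvdnP[q' qE]|nbq] := boolP (base k ^ n %| q)%N.
  exists i0 => z; have [x ->] := partial_num_i0 k.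
  have -> : q%:R * ((x * gap k + 1)%:R / ((base k)%:R ^+ n * (gap k)%:R)) =
      (q' * (x * gap k + 1))%:R / (gap k)%:R :> R.
    by rewrite qE [in RHS]natrM natrM natrX; field; rewrite !gt_eqF ?exprn_gt0.
  apply: dist_frac_ge; first exact: gap_gt0.
  rewrite mulnDr muln1 mulnA dvdn_addr ?(dvdn_mull _ (dvdnn _))//.
  rewrite gtnNdvd//.
    by move: q0; rewrite qE muln_gt0 => /andP[].
  by move: qD; rewrite qE levelS mulnC ltn_pmul2l// expn_gt0 base_gt0.
have [j [jn /dvdnP[q' qE] nbj]] :=
  exists_switch (P := fun j => (base k ^ j %| q)%N) (dvd1n q) nbq.
have [i ii0 rj] := rank_surj jn.
exists i => z; have [x bx ->] := partial_num k ii0.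
have -> : q%:R * (x.+1%:R / (base k)%:R ^+ (rank i).+1) =
    (q' * x.+1)%:R / (base k)%:R :> R.
  rewrite qE rj [in RHS]natrM natrM natrX exprS.
  by field; rewrite !gt_eqF ?exprn_gt0.
apply: (@le_trans _ _ (base k)%:R^-1).
  by rewrite lef_pV2 ?posrE// ler_nat base_le_gap.
apply: dist_frac_ge; first exact: base_gt0.
rewrite Gauss_dvdl ?coprime_succ_of_dvdn_sqr//; apply: contra nbj => bq'.
by rewrite qE expnS dvdn_mul.
Qed.

Lemma dist_xi_ge k q : (0 < q)%N -> (q < level k.+1)%N ->
  exists i, (gap k)%:R^-1 - tail k <= dist_int (q%:R * xi 0 i).
Proof.
move=> q0 qD; have [i hi] := dist_partial_ge q0 qD; exists i.
apply: dist_int_ge => z; have h1 := hi z.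
have h2 := dist_xi_tail i (ltnW qD).
have := ler_distD (q%:R * xi 0 i) (q%:R * partial k.+1 i) z%:~R.
rewrite (distrC (q%:R * partial k.+1 i) (q%:R * xi 0 i)); lra.
Qed.

Lemma exp_base_mul_partial k j i : (0 < j)%N -> exists z : nat,
  (base k ^ j)%:R * partial k.+1 i = z%:R + (base k ^ j)%:R / (unit_den k i)%:R.
Proof.
move=> j0; have [p hp] := partial_frac k i.
exists (base k ^ j %/ level k * p)%N.
rewrite partialS hp mulrDr natrM natr_divn ?level_gt0//.
  by congr (_ + _); rewrite mulrA mulrAC.
by rewrite -(prednK j0) expnS dvdn_mulr// dvdn_level_base.
Qed.

Lemma dist_xi_exp_le k j i : (0 < j <= n)%N ->
  dist_int ((base k ^ j)%:R * xi 0 i) <=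
  (base k ^ j)%:R / (unit_den k i)%:R + tail k.
Proof.
move=> /andP[j0 jn]; have [z hz] := exp_base_mul_partial k i j0.
apply: le_trans (dist_int_le _ z) _.
have bjD : (base k ^ j <= level k.+1)%N.
  apply: dvdn_leq (level_gt0 _) _; rewrite levelS dvdn_mulr// dvdn_exp2l//.
have := dist_xi_tail i bjD; rewrite hz.
set y := _ / _; have y0 : 0 <= y by rewrite divr_ge0 ?ler0n.
by rewrite !ler_distl -pmulrn; lra.
Qed.

Lemma dist_xi_exp_le_tail k j i : (0 < j <= n)%N -> i != i0 -> (rank i < j)%N ->
  dist_int ((base k ^ j)%:R * xi 0 i) <= tail k.
Proof.
move=> /andP[j0 jn] ii0 rij; have [z hz] := exp_base_mul_partial k i j0.
have bjD : (base k ^ j <= level k.+1)%N.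
  apply: dvdn_leq (level_gt0 _) _; rewrite levelS dvdn_mulr// dvdn_exp2l//.
have db : (unit_den k i %| base k ^ j)%N.
  by rewrite /unit_den (negbTE ii0) dvdn_exp2l.
have := dist_xi_tail i bjD; rewrite hz -natr_divn ?unit_den_gt0// -natrD.
by apply: le_trans; exact: (dist_int_le _ (z + base k ^ j %/ unit_den k i)%N).
Qed.


Lemma level_bracket k0 (Q : R) : (level k0)%:R <= Q ->
  exists2 k, (k0 <= k)%N & (level k)%:R <= Q < (level k.+1)%:R.
Proof.
move=> k0Q; pose P j := (level (k0 + j))%:R <= Q.
have P0 : P 0%N by rewrite /P addn0.
have nP : ~~ P (Num.truncn Q).+2.
  rewrite -ltNge; apply: (lt_le_trans (real_truncnS_gt (num_real Q))).
  rewrite ler_nat addnS; apply: leq_trans (level_gt _).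
  by rewrite addnS ltnS leqW// leq_addl.
have [j [_ Pj nPj]] := exists_switch P0 nP.
exists (k0 + j)%N; first exact: leq_addr.
by move: nPj; rewrite /P addnS -ltNge => ->; rewrite andbT.
Qed.

Lemma tail_le_inv_base k : tail k <= 2 / (base k)%:R.
Proof.
rewrite ler_wpM2l// lef_pV2 ?posrE ?mulr_gt0// -natrM ler_nat.
by apply: leq_trans (base_le_level k) _; rewrite leq_pmulr ?s_gt0.
Qed.

Lemma inv_base_le_inv_s k : (base k)%:R^-1 <= (s k)%:R^-1 :> R.
Proof. by rewrite lef_pV2 ?posrE// ler_nat s_le_base. Qed.

(** The choice is q = level k below base k, and q = base k from there on: the
    former leaves an error 2 level / base, and the latter at most 3 / base in
    each coordinate. *)
Lemma good_q_below_exp k (Q : R) : (level k)%:R <= Q -> Q < (base k)%:R ^+ n ->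
  exists q v, [/\ (0 < q)%N, q%:R <= Q, 0 <= v,
    forall i, dist_int (q%:R * xi 0 i) <= v &
    Q * v ^+ n.+1 <= 3 ^+ n.+1 / (s k)%:R].
Proof.
move=> DQ Qb; have Q0 : 0 <= Q by apply: le_trans DQ; rewrite ler0n.
have [Qb1|bQ] := ltP Q (base k)%:R.
  (* base * (level / base)^2 = 1 / s, and n + 1 >= 2. *)
  exists (level k), (2 * ((level k)%:R / (base k)%:R)).
  have Db0 : 0 <= (level k)%:R / (base k)%:R :> R by rewrite divr_ge0 ?ltW.
  split=> [|//||i|]; [exact: level_gt0|by rewrite mulr_ge0| |].
    have [p hp] := level_mul_partial k i; apply: le_trans (dist_int_le _ p) _.
    rewrite -pmulrn -hp; apply: le_trans (dist_xi_partial _ _ _) _.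
    by rewrite mulrCA.
  rewrite exprMn mulrCA; apply: ler_pM; rewrite ?mulr_ge0 ?exprn_ge0//.
    by apply: lerXn2r; rewrite ?nnegrE// ler_nat.
  have -> : (s k)%:R^-1 = (base k)%:R * ((level k)%:R / (base k)%:R) ^+ 2 :> R.
    by rewrite /base natrM natrX; field; rewrite !gt_eqF.
  apply: ler_pM; rewrite ?exprn_ge0 ?(ltW Qb1)//.
  apply: ler_wiXn2l; rewrite ?Db0//.
  by rewrite ler_pdivrMr// mul1r ler_nat level_le_base.
exists (base k), (3 / (base k)%:R); split=> [|//||i|]; first exact: base_gt0.
- by rewrite divr_ge0 ?ltW.
- have tb := tail_le_inv_base k.
  have -> : 3 / (base k)%:R = (base k)%:R^-1 + 2 / (base k)%:R :> R by ring.
  have b1 : (0 < 1 <= n)%N by rewrite n0.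
  have [ri|ri] := boolP ((i != i0) && (rank i == 0 :> nat)%N).
    have /andP[ii0 /eqP r0] := ri.
    have := @dist_xi_exp_le_tail k 1 i b1 ii0; rewrite r0 expn1 => /(_ isT).
    have : 0 < (base k)%:R^-1 :> R by rewrite invr_gt0.
    lra.
  have := dist_xi_exp_le k i b1; rewrite expn1 => h; apply: le_trans h _.
  apply: lerD => //; rewrite ler_pdivrMr// mulrC ler_pdivlMr// -natrM ler_nat.
  move: ri; rewrite negb_and negbK /unit_den; case: eqP => [_ _|_ /= r0].
    rewrite levelS; apply: (leq_mul _ (base_le_gap k)).
    by apply: dvdn_leq (dvdn_base_exp k); rewrite expn_gt0 base_gt0.
  by rewrite mulnn; apply: leq_pexp2l; rewrite ?base_gt0// ltnS lt0n.
- rewrite expr_div_n mulrCA ler_wpM2l ?exprn_ge0//.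
  apply: le_trans (inv_base_le_inv_s k).
  rewrite ler_pdivrMr ?exprn_gt0// exprS mulKf ?gt_eqF//.
  exact: ltW.
Qed.

(** Up to the factor chi, the value that the function with the limit superior
    approaches at the end of stage k. *)
Definition peak k : R := (level k.+1)%:R `^ (n.+1%:R^-1) / (gap k)%:R.

Lemma peak_ge0 k : 0 <= peak k.
Proof. by rewrite divr_ge0 ?powR_ge0 ?ltW. Qed.

Lemma peak_expr k : peak k ^+ n.+1 = ((s k)%:R / (K k)%:R) ^+ n.
Proof.
rewrite /peak expr_div_n root_expr ?ltW// levelS natrM natrX exprS.
have -> : (s k)%:R / (K k)%:R = (base k)%:R / (gap k)%:R :> R.
  rewrite /base /gap (natrM _ _ (s k)) (natrM _ _ (K k)) natrX; field.
  by rewrite !gt_eqF// ltr0n K_gt0.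
by rewrite expr_div_n; field; rewrite !gt_eqF ?exprn_gt0.
Qed.

Lemma peak_le1 k : peak k <= 1.
Proof.
rewrite -(@ler_pXn2r _ n.+1) ?nnegrE ?peak_ge0// peak_expr expr1n.
apply: exprn_ile1; first by rewrite divr_ge0.
by rewrite ler_pdivrMr ?ltr0n ?K_gt0// mul1r ler_nat.
Qed.

(** * The Dirichlet constant of the vector *)

Variable N : 'rV[R]_n.+1 -> R.
Hypothesis hN : is_norm N.
Hypothesis hexp : expanding N.
Hypothesis i0_min : forall i, N (base_vec R i0) <= N (base_vec R i).

Let chi0 := N (base_vec R i0).
Let C := \sum_i N (base_vec R i).
Local Notation f Q := (Q `^ (n.+1%:R^-1) * min_approx N xi Q).

Let chi0_gt0 : 0 < chi0. Proof. exact: norm_base_vec_gt0. Qed.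

Let C_ge0 : 0 <= C. Proof. by apply: sumr_ge0 => i _; exact: norm_ge0. Qed.

Lemma min_approx_xi_ge k (Q : R) : 1 <= Q -> Q < (level k.+1)%:R ->
  ((gap k)%:R^-1 - tail k) * chi0 <= min_approx N xi Q.
Proof.
move=> Q1 QD; apply: min_approx_ge => // q q0 qQ.
have qD : (q < level k.+1)%N by rewrite -(ltr_nat R) (le_lt_trans qQ).
have [i hi] := dist_xi_ge q0 qD.
apply: le_trans (norm_approx_vec_ge hN xi q i hexp).
apply: (@le_trans _ _ (dist_int (q%:R * xi 0 i) * chi0)).
  by rewrite ler_wpM2r// ltW.
by rewrite ler_wpM2l ?dist_int_ge0.
Qed.

Lemma dirichlet_fun_small k (Q e : R) :
  (level k)%:R <= Q -> Q < (base k)%:R ^+ n -> 0 < e ->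
  (3 * C / e) ^+ n.+1 <= (s k)%:R -> f Q <= e.
Proof.
move=> DQ Qb e0 hs.
have Q0 : 0 <= Q by apply: le_trans DQ; rewrite ler0n.
have [q [v [q0 qQ v0 hv Qv]]] := good_q_below_exp DQ Qb.
apply: (@le_trans _ _ (Q `^ (n.+1%:R^-1) * (v * C))).
  rewrite ler_wpM2l ?powR_ge0//; apply: le_trans (min_approx_le hN xi q0 qQ) _.
  apply: le_trans (norm_approx_vec_le hN _ _) _; rewrite mulr_sumr.
  by apply: ler_sum => i _; rewrite ler_wpM2r ?norm_ge0.
apply: mul_root_le; rewrite ?mulr_ge0 ?(ltW e0)//.
rewrite exprMn mulrA; apply: (@le_trans _ _ (3 ^+ n.+1 / (s k)%:R * C ^+ n.+1)).
  by rewrite ler_wpM2r ?exprn_ge0.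
rewrite mulrAC -exprMn ler_pdivrMr//.
rewrite [X in _ <= X]mulrC -ler_pdivrMr ?exprn_gt0//.
by rewrite -expr_div_n.
Qed.

Lemma dirichlet_fun_large k (Q : R) :
  (base k)%:R ^+ n <= Q -> Q < (level k.+1)%:R ->
  f Q <= peak k * chi0 + 2 * C / (s k.+1)%:R.
Proof.
move=> bQ QD.
have Q1 : 1 <= Q.
  by apply: le_trans bQ; rewrite exprn_ege1// ler1n base_gt0.
have q0 : (0 < base k ^ n)%N by rewrite expn_gt0 base_gt0.
have qQ : (base k ^ n)%:R <= Q by rewrite natrX.
have nn : (0 < n <= n)%N by rewrite n0 leqnn.
have hmin : min_approx N xi Q <= chi0 / (gap k)%:R + tail k * C.
  apply: le_trans (min_approx_le hN xi q0 qQ) _.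
  apply: le_trans (norm_approx_vec_le hN _ _) _.
  rewrite /C (bigD1 i0)//= [X in tail k * X](bigD1 i0)//= mulrDr addrA -/chi0.
  apply: lerD.
    have := dist_xi_exp_le k i0 nn; rewrite /unit_den eqxx levelS natrM natrX.
    rewrite -[X in X / _]mulr1 -mulf_div divff ?gt_eqF ?exprn_gt0//.
    rewrite !mul1r => h.
    apply: le_trans (ler_wpM2r (norm_ge0 hN _) h) _.
    by rewrite mulrDl mulrC.
  rewrite mulr_sumr; apply: ler_sum => i ii0; rewrite ler_wpM2r ?norm_ge0//.
  exact: dist_xi_exp_le_tail nn ii0 (rank_lt ii0).
have D1 : 1 <= (level k.+1)%:R :> R by rewrite ler1n level_gt0.
have rootD : Q `^ (n.+1%:R^-1) <= (level k.+1)%:R `^ (n.+1%:R^-1).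
  by apply: ge0_ler_powR; rewrite ?invr_ge0 ?nnegrE ?(ltW QD) ?(le_trans _ Q1).
have rhs0 : 0 <= chi0 / (gap k)%:R + tail k * C.
  by rewrite addr_ge0 ?mulr_ge0 ?tail_ge0 ?invr_ge0 ?(ltW chi0_gt0) ?ler0n.
apply: le_trans (ler_wpM2l (powR_ge0 _ _) hmin) _.
apply: le_trans (ler_wpM2r rhs0 rootD) _.
rewrite mulrDr; apply: lerD; first by rewrite mulrCA mulrC.
rewrite mulrA [X in _ <= X](_ : _ = 2 / (s k.+1)%:R * C); last by ring.
rewrite ler_wpM2r// -level_mul_tail ler_wpM2r ?tail_ge0//.
exact: root_le_id.
Qed.

(** Evaluated at Q = level k.+1 - 1, the last integer at which level k.+1 itself
    is not yet a candidate for q; passing from level k.+1 to Q costs a factor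
    1 - 1 / level k.+1. *)
Lemma dirichlet_fun_peak k : (0 < k)%N -> exists2 Q, k%:R <= Q &
    peak k * chi0 - chi0 * (2 / (s k.+1)%:R + (level k.+1)%:R^-1) <= f Q.
Proof.
move=> k0; have D0 := level_R_gt0 k.+1; set d := (level k.+1)%:R.
have kd : k%:R + 1 <= d by rewrite /d natr1 ler_nat level_gt.
have k1 : 1 <= k%:R :> R by rewrite ler1n.
exists (d - 1); first by lra.
have d1 : 1 <= d - 1 by lra.
have dd : d - 1 < d by lra.
have hmin := min_approx_xi_ge d1 dd.
pose T := d `^ (n.+1%:R^-1) * tail k.
have T0 : 0 <= T by rewrite mulr_ge0 ?powR_ge0 ?tail_ge0.
have Ts : T <= 2 / (s k.+1)%:R.
  by rewrite -level_mul_tail ler_wpM2r ?tail_ge0// root_le_id//; lra.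
have u0 : 0 < d^-1 by rewrite invr_gt0.
have P1 := peak_le1 k; have P0 := peak_ge0 k.
have PT : d `^ (n.+1%:R^-1) * ((gap k)%:R^-1 - tail k) = peak k - T.
  by rewrite mulrBr.
rewrite -[X in X - _]mulrC -mulrBr.
(* When the tail exceeds 1 / gap, the claimed bound is not positive. *)
have [tL|Lt] := leP (tail k) (gap k)%:R^-1; last first.
  have PT0 : peak k - T <= 0.
    by rewrite -PT mulr_ge0_le0 ?powR_ge0// subr_le0 ltW.
  apply: (@le_trans _ _ 0).
    by rewrite mulr_ge0_le0 ?(ltW chi0_gt0)//; lra.
  rewrite mulr_ge0 ?powR_ge0//; apply: min_approx_ge => // q q_gt0 _.
  exact: norm_ge0.
have PT0 : 0 <= peak k - T by rewrite -PT mulr_ge0 ?powR_ge0// subr_ge0.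
apply: (@le_trans _ _ ((1 - d^-1) * (peak k - T) * chi0)).
  rewrite mulrC ler_wpM2r ?(ltW chi0_gt0)//.
  have : 0 <= d^-1 * T by rewrite mulr_ge0// ltW.
  have : d^-1 * peak k <= d^-1 by rewrite ler_piMr// ltW.
  lra.
rewrite -PT.
apply: le_trans (ler_wpM2l (powR_ge0 _ _) hmin).
rewrite !mulrA ler_wpM2r ?(ltW chi0_gt0)// ler_wpM2r ?subr_ge0//.
have -> : d - 1 = (1 - d^-1) * d by rewrite mulrBl mul1r mulVf ?gt_eqF.
apply: root_mul_id_le; first exact: ltW.
have : d^-1 < 1 by rewrite invf_lt1//; lra.
lra.
Qed.

Lemma dirichlet_constant_xi (l : R) : 0 <= l -> (forall k, l <= peak k) ->
  (forall e, 0 < e -> exists k0, forall k, (k0 <= k)%N -> peak k <= l + e) ->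
  dirichlet_constant N xi = (l * chi0)%:E.
Proof.
move=> l0 peak_lo peak_hi.
have s_large (x : R) : exists k0, forall k, (k0 <= k)%N -> x <= (s k)%:R.
  exists (Num.truncn x) => k xk; apply/ltW.
  apply: (lt_le_trans (real_truncnS_gt (num_real x))).
  by rewrite ler_nat (leq_ltn_trans xk (s_gt k)).
have lchi0 : 0 <= l * chi0 by rewrite mulr_ge0// ltW.
apply: limf_esup_pinfty_eq => [e e0|e M e0].
  have e20 : 0 < e / 2 by rewrite divr_gt0.
  have [k1 hk1] := peak_hi _ (divr_gt0 e20 chi0_gt0).
  have [k2 hk2] := s_large (Num.max ((3 * C / e) ^+ n.+1) (2 * C / (e / 2))).
  exists (level (maxn k1 k2))%:R => Q /ltW /level_bracket[k].
  rewrite geq_max => /andP[k1k k2k] /andP[DQ QD].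
  have := hk2 _ k2k; rewrite ge_max => /andP[s1 _].
  have := hk2 _ (leqW k2k); rewrite ge_max => /andP[_ s2].
  have [Qb|bQ] := ltP Q ((base k)%:R ^+ n).
    by apply: le_trans (dirichlet_fun_small DQ Qb e0 s1) _; rewrite lerDr.
  apply: le_trans (dirichlet_fun_large bQ QD) _.
  have : peak k * chi0 <= l * chi0 + e / 2.
    rewrite -[e / 2](divfK (lt0r_neq0 chi0_gt0)) -mulrDl.
    by rewrite ler_wpM2r ?hk1 ?(ltW chi0_gt0).
  have : 2 * C / (s k.+1)%:R <= e / 2.
    by rewrite ler_pdivrMr// [X in _ <= X]mulrC -ler_pdivrMr.
  lra.
have [k2 hk2] := s_large (3 * chi0 / e).
have [k3 Mk3] : exists k3, M < k3%:R.
  by exists (Num.truncn M).+1; exact: real_truncnS_gt (num_real M).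
pose k := maxn k2 k3.+1.
have k0 : (0 < k)%N by rewrite leq_max orbT.
have [Q kQ hQ] := dirichlet_fun_peak k0.
exists Q.
  apply: lt_le_trans kQ; apply: lt_le_trans Mk3 _.
  by rewrite ler_nat leq_max leqnSn orbT.
apply: le_trans hQ; apply: lerB; first by rewrite ler_wpM2r// ltW.
have sD : (level k.+1)%:R^-1 <= (s k)%:R^-1 :> R.
  apply: le_trans (inv_base_le_inv_s k).
  by rewrite lef_pV2 ?posrE// ler_nat base_le_level.
have bound j : (k2 <= j)%N -> chi0 * (s j)%:R^-1 <= e / 3.
  by move=> /hk2; rewrite ler_pdivrMr// => h; rewrite ler_pdivrMr//; lra.
have := bound _ (leq_maxl k2 k3.+1); have := bound _ (leqW (leq_maxl k2 k3.+1)).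
have := ler_wpM2l (ltW chi0_gt0) sD; rewrite -/k mulrDr; lra.
Qed.

End Construction.

(** * Every target ratio is attained *)

(** s must tend to infinity even when t = 0, whence the summand k + 1; taking K
    quadratic in k makes its effect on the ratio vanish. *)
Lemma ratio_sequence (R : realType) (t : R) : 0 <= t <= 1 ->
  exists s K : nat -> nat, [/\ forall k, (k < s k)%N, forall k, (s k <= K k)%N &
    forall k, t <= (s k)%:R / (K k)%:R <= t + k.+1%:R^-1].
Proof.
move=> /andP[t0 t1]; pose K k := (k.+1 ^ 2)%N.
pose s k := minn (K k) (Num.truncn (t * (K k)%:R) + k.+1).
have K0 k : 0 < (K k)%:R :> R by rewrite ltr0n expn_gt0.
exists s, K; split=> k; last 1 first.
- have tK : 0 <= t * (K k)%:R by rewrite mulr_ge0// ltW.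
  have /andP[tr1 tr2] := truncn_itv tK.
  rewrite ler_pdivlMr// ler_pdivrMr// mulrDl.
  have -> : k.+1%:R^-1 * (K k)%:R = k.+1%:R :> R.
    by rewrite natrX expr2 mulKf.
  apply/andP; split; last first.
    by apply: le_trans (_ : _ <= (Num.truncn (t * (K k)%:R) + k.+1)%:R) _;
      rewrite ?ler_nat ?geq_minr// natrD lerD2r.
  rewrite /s /minn; case: ifP => _; first by rewrite ler_piMl// ltW.
  by apply: le_trans (ltW tr2) _; rewrite ler_nat -addn1 leq_add2l.
- by rewrite leq_min leq_addl andbT /K expnS leq_pmulr.
- exact: geq_minl.
Qed.


Theorem corollary4 (R : realType) (m : nat) (hm : (2 <= m)%N)
    (N : 'rV[R]_m -> R) (hN : is_norm N) (hexp : expanding N) :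
  0 < chi N /\ EFin @` `[0, chi N] `<=` dirichlet_spectrum N.
Proof.
case: m hm N hN hexp => [//|n]; rewrite ltnS => n0 N hN hexp.
have [i0 chiE i0_min] := chi_attained hN (ltn0Sn n).
have chi_gt0 : 0 < chi N by rewrite chiE; exact: norm_base_vec_gt0.
split=> // x [c]; rewrite /= in_itv /= => /andP[c0 cchi] <-{x}.
pose l := c / chi N.
have l0 : 0 <= l by rewrite divr_ge0// ltW.
have l1 : l <= 1 by rewrite ler_pdivrMr// mul1r.
have nR : n%:R != 0 :> R by rewrite pnatr_eq0 -lt0n.
(* Peaks have (n+1)-st power (s / K)^n, so s / K must tend to this t. *)
pose t := l `^ (n.+1%:R / n%:R).
have tE : t ^+ n = l ^+ n.+1.
  by rewrite -!powR_mulrn ?powR_ge0// /t -powRrM divfK.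
have t01 : 0 <= t <= 1.
  rewrite powR_ge0 /= -(@ler_pXn2r _ n) ?nnegrE ?powR_ge0//.
  by rewrite tE expr1n exprn_ile1.
have [s [K [s_gt s_le sK]]] := ratio_sequence t01.
have ratio0 k : 0 <= (s k)%:R / (K k)%:R :> R by rewrite divr_ge0.
have cE : c = l * N (base_vec R i0) by rewrite -chiE divfK// gt_eqF.
exists (xi R i0 s K) => //; rewrite cE.
apply: dirichlet_constant_xi => // [k|e e0].
  rewrite -(@ler_pXn2r _ n.+1) ?nnegrE ?peak_ge0// peak_expr// -tE.
  apply: lerXn2r; rewrite ?nnegrE ?powR_ge0//.
  by have /andP[] := sK k.
have : (fun k => (t + k.+1%:R^-1) ^+ n) @ \oo --> (t + 0) ^+ n.
  have cvg_t : (fun k => t + k.+1%:R^-1) @ \oo --> t + 0.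
    by apply: cvgD; [exact: cvg_cst|exact: cvg_harmonic].
  exact: continuous_cvg (@exprn_continuous R n (t + 0)) cvg_t.
have le : l ^+ n.+1 < (l + e) ^+ n.+1.
  by rewrite ltrXn2r//; lra.
rewrite addr0 tE => /cvgr_lt /(_ _ le) [k0 _ hk0].
exists k0 => k /hk0 /= /ltW hk.
rewrite -(@ler_pXn2r _ n.+1) ?nnegrE ?peak_ge0 ?addr_ge0 ?(ltW e0)//.
rewrite peak_expr//.
apply: le_trans hk; have /andP[_ sk] := sK k.
by apply: lerXn2r; rewrite ?nnegrE// (le_trans (ratio0 k)).
Qed.
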